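(* Let $x_0\in\mathbb R$, let $(h_n)_{n\ge 0}$ be a non-increasing sequence of positive real numbers and $(\rho_n)_{n\ge 1}$ a sequence of nonnegative real numbers, and suppose that $(h_n)$ and $(\rho_n)$ satisfy Condition (A) or Condition (B) of the context with $w_n=\rho_n$. Let $(\xi_n)_{n\ge1}$ be a sequence of random variables with $|\xi_n|\le 1$ for all $n$. Let $(x_n)$ be the solution of $$x_{n+1}=x_n(1-h_nx_n^2)+\rho_{n+1}\xi_{n+1},\qquad n=0,1,2,\dots,$$ with initial value $x_0$, let $(\hat h_n)$ be the stopped timestep sequence defined in the context, and let $(\hat x_n)$ be the solution, with $\hat x_0=x_0$, of $$\hat x_{n+1}=\hat x_n(1-\hat h_n\hat x_n^2)+\rho_{n+1}\xi_{n+1},\qquad n=0,1,2,\dots.$$ Then, almost surely: (i) $\lim_{n\to\infty}x_n=L$, where $L$ is an a.s. finite random variable; (ii) $\lim_{n\to\infty}\hat x_n=0$.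
   Context: All random variables live on a complete probability space $(\Omega,\mathcal F,\mathbb P)$. Notation: $\ln_0 b=b$ and $\ln_i b=\ln(\ln_{i-1}b)$ is the $i$-fold iterated logarithm; $e_{[0]}^1=1$ and $e_{[k]}^1=\exp(e_{[k-1]}^1)$, with $e^1_{[1]}=e$ (so $e_{[k]}^1$ is the $k$-fold iterated exponential evaluated at $1$, i.e. $e^1_{[1]}=e$, $e^1_{[2]}=e^e$, etc.). For $k\in\mathbb N$ put $P_k(n)=\prod_{i=0}^{k}\ln_i\big(n+e_{[k]}^1\big)=(n+e_{[k]}^1)\ln(n+e_{[k]}^1)\cdots\ln_k(n+e_{[k]}^1)$. For a real sequence $(w_n)_{n\ge1}$: Condition (A): there exist $k\in\mathbb N$ and $\beta\in(0,1)$ such that $(h_n)$ is decreasing, $h_n\le \exp\{-3^{n+1}/P_k(n)\}$ for all $n$, and $|w_n|\le (\beta/P_k(n))^{3^n}$ for all $n$. Condition (B): there exists $\beta\in(0,1)$ such that $h_n\le e^{-3^{n+1}}$ and $|w_n|\le \left[\frac{\beta(e-1)}{e}\right]^{3^n}$ for all $n$. Stopped timestep sequence: $\hat h_n=h_n$ for $n<N_3$ and $\hat h_n=h_{N_3}$ for $n\ge N_3$, where $N_3$ is an a.s. finite random index (depending on the trajectory) selected either as an index with $|x_{N_3}|\le 1$, or as $N_3=\inf\{n: h_nx_n^2<1\}$. (The solutions $x_n$ and $\hat x_n$ coincide for $n\le N_3$.) *)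

(* Defs.v *)
(* MathComp-Analysis development, over an arbitrary R : realType. *)
From HB Require Import structures.
From mathcomp Require Import all_boot all_order all_algebra.
From mathcomp Require Import all_classical all_reals all_analysis.
Set Implicit Arguments.
Unset Strict Implicit.
Unset Printing Implicit Defensive.
Import Order.TTheory GRing.Theory Num.Theory.
Import numFieldNormedType.Exports.
Local Open Scope classical_set_scope.
Local Open Scope ring_scope.

Section Defs.
Variable R : realType.
Implicit Types (h w f x : nat -> R).

Definition iter_ln (i : nat) (b : R) : R := iter i (@ln R) b.

Definition iter_exp1 (k : nat) : R := iter k (@expR R) 1.

(* [ln] is 0 off the positive reals, but here all the arguments are positive:
   ln_i (n + e_[k]) >= ln_i (e_[k]) = e_[k - i] >= 1 for i <= k. *)
Definition P_ (k n : nat) : R :=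
  \prod_(i < k.+1) iter_ln i (n%:R + iter_exp1 k).

(* Sequences (w_n)_{n >= 1} are functions on nat whose value at 0 is ignored,
   whereas (h_n) starts at n = 0. "Decreasing" is meant in the wide sense. *)
Definition condition_A h w : Prop :=
  exists (k : nat) (beta : R),
    [/\ 0 < beta < 1,
        nonincreasing_seq h,
        forall n, h n <= expR (- (3 ^+ n.+1 / P_ k n)) &
        forall n, (1 <= n)%N -> `|w n| <= (beta / P_ k n) ^+ (3 ^ n)].

Definition condition_B h w : Prop :=
  exists beta : R,
    [/\ 0 < beta < 1,
        forall n, h n <= expR (- 3 ^+ n.+1) &
        forall n, (1 <= n)%N ->
          `|w n| <= (beta * (expR 1 - 1) / expR 1) ^+ (3 ^ n)].

Fixpoint cubic_sol h f (x0 : R) (n : nat) : R :=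
  if n is m.+1 then
    let y := cubic_sol h f x0 m in y * (1 - h m * y ^+ 2) + f m.+1
  else x0.

(* A random index takes its values in nat extended by infinity, encoded as
   [option nat] with [None] for infinity. *)
Definition stopped_step h (N : option nat) (n : nat) : R :=
  if N is Some m then (if (n < m)%N then h n else h m) else h n.

(* N = inf A, with inf set0 = infinity *)
Definition is_first_index (A : set nat) (N : option nat) : Prop :=
  if N is Some m then A m /\ (forall n, A n -> (m <= n)%N) else A = set0.

(* The two admissible ways of choosing the index along a trajectory x.
   Finiteness of the infimum in the second one is not presupposed. *)
Definition stopping_index h x (N : option nat) : Prop :=
  (exists2 m, N = Some m & `|x m| <= 1) \/
  is_first_index [set n | h n * x n ^+ 2 < 1] N.

End Defs.

(* Main.v *)
Require Import Defs.
From HB Require Import structures.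
From mathcomp Require Import all_boot all_order all_algebra.
From mathcomp Require Import all_classical all_reals all_analysis.
From mathcomp Require Import measurable_realfun ring lra zify.
Import Order.TTheory GRing.Theory Num.Theory.
Import numFieldNormedType.Exports.
Local Open Scope classical_set_scope.
Local Open Scope ring_scope.

(** The proof is pathwise: fix a trajectory along which |xi_n| <= 1 for all
    n >= 1. The whole argument turns on the region h_n x_n^2 <= 1, in which the
    factor 1 - h_n x_n^2 lies in [0, 1].

    The trajectory enters the region ([enters_region]). Outside it the cubic
    term dominates, so that |x_{n+1}| <= h_n |x_n|^3 ([cubic_step_le]); hence
    ln |x_n| / 3^n drops by at least - ln h_n / 3^{n+1} at each step, which is
    at least 1 / P_k(n) under (A) and at least 1 under (B). Since |x_n| >= 1
    there, these logarithms stay nonnegative, which contradicts the divergence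
    of the sum of the drops. The series of the 1 / P_k(n) diverges because
    1 / P_k(n) bounds an increment of ln_{k+1} ([sum_invP_ge]).

    The region cannot be left ([region_step]): both conditions force h_n <= 1
    and |rho_n xi_n| <= 1/2, and u = sqrt(h_n) x_n satisfies
    |u - u^3| <= 1/2 when |u| <= 1.

    Inside the region |x_{n+1}| <= |x_n| - h_n |x_n|^3 + |rho_{n+1} xi_{n+1}|,
    and the noise is summable; summing, the total dissipation, which is the sum
    of the h_n |x_n|^3, is finite ([dissipation_summable]). As h_n |x_n|^3 and
    the noise are the two parts of the increment of x_n, the trajectory has
    bounded variation and converges ([cubic_sol_cvg]). This uses only that the
    steps are nonincreasing, so it applies to the stopped steps too; these are
    eventually a positive constant, so that summability of the dissipation gives
    x_n -> 0 ([cubic_sol_cvg0]). An index chosen by either stopping rule is one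
    at which the trajectory is in the region. *)

(** * Iterated logarithms and divergence of the sum of the 1 / P_k(n) *)

(** The comparison with an iterated exponential keeps all the arguments of ln
    positive. *)
Lemma le_iter_ln (R : realType) j (a b : R) :
  iter j (@expR R) a <= b -> a <= iter_ln j b.
Proof.
elim: j b => [|j IH] b //=.
move=> le_b; rewrite /iter_ln -iterS iterSr.
apply: IH.
have b_gt0 : 0 < b := lt_le_trans (expR_gt0 _) le_b.
by rewrite -ler_expR lnK ?posrE.
Qed.

Lemma iter_exp1_ge1 (R : realType) k : 1 <= iter_exp1 R k.
Proof.
elim: k => [|k IH] //=; rewrite /iter_exp1 /=.
by apply: le_trans (expR_ge1Dx _); rewrite lerDl (le_trans ler01 IH).
Qed.

Lemma iter_ln_ge1 (R : realType) k i (b : R) :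
  (i <= k)%N -> iter_exp1 R k <= b -> 1 <= iter_ln i b.
Proof.
move=> ik le_b; apply: (le_trans (iter_exp1_ge1 R (k - i))).
by apply: le_iter_ln; rewrite -iterD subnKC.
Qed.

Lemma ler_lnB (R : realType) (a b : R) :
  0 < a -> 0 < b -> ln b - ln a <= (b - a) / a.
Proof.
move=> a0 b0; rewrite -ln_div ?posrE// mulrBl divff ?gt_eqF//.
have := @le_ln1Dx R (b / a - 1); rewrite [1 + _]addrC subrK; apply.
by rewrite ltrBrDl subrr divr_gt0.
Qed.

(** By concavity an increment of ln at c is at most the increment of its
    argument divided by c; iterating this, as in the chain rule, gives the
    product in the denominator. *)
Lemma iter_lnB_le (R : realType) k j (b : R) :
  (j <= k.+1)%N -> iter_exp1 R k <= b ->
  iter_ln j (b + 1) - iter_ln j b <= (\prod_(i < j) iter_ln i b)^-1.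
Proof.
move=> + le_b; elim: j => [_|j IH jk].
  by rewrite big_ord0 invr1 /iter_ln /= addrAC subrr add0r.
have lnj_gt0 c : iter_exp1 R k <= c -> 0 < iter_ln j c.
  by move=> le_c; rewrite (lt_le_trans ltr01)// (@iter_ln_ge1 _ k).
have b1 : iter_exp1 R k <= b + 1 by rewrite (le_trans le_b)// lerDl.
have := ler_lnB _ _ _ (lnj_gt0 _ le_b) (lnj_gt0 _ b1).
rewrite big_ord_recr /= invfM => /le_trans; apply.
by rewrite ler_wpM2r ?invr_ge0 ?(ltW (lnj_gt0 _ le_b))// IH// ltnW.
Qed.

(** Telescoping: the term of index i dominates the increment of ln_{k+1} from
    i + e_[k] to i + 1 + e_[k], and ln_{k+1} vanishes at e_[k]. *)
Lemma sum_invP_ge (R : realType) k n :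
  iter_ln k.+1 (n%:R + iter_exp1 R k) <= \sum_(i < n) (P_ R k i)^-1.
Proof.
elim: n => [|n IH].
  rewrite big_ord0 add0r /iter_ln /iter_exp1 /=.
  suff -> : iter k (@ln R) (iter k expR 1) = 1 by rewrite ln1.
  elim: k => [//|k IH]; rewrite iterSr /= expRK; exact: IH.
rewrite big_ord_recr [leRHS]/= -natr1 addrAC.
have := @iter_lnB_le R k k.+1 (n%:R + iter_exp1 R k) (leqnn _).
rewrite lerDr => /(_ (ler0n _ _)); rewrite -/(P_ R k n).
by move: IH; lra.
Qed.

Lemma sum_invP_unbounded (R : realType) k (A : R) :
  exists n, A < \sum_(i < n) (P_ R k i)^-1.
Proof.
pose B := iter k.+1 (@expR R) (A + 1).
exists (Num.bound B); apply: lt_le_trans (sum_invP_ge R k _).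
rewrite -[ltLHS]addr0 (@lt_le_trans _ _ (A + 1)) ?ltrD2l//.
apply: le_iter_ln; rewrite -/B.
rewrite (le_trans (ltW (archi_boundP (expR_ge0 _))))// lerDl.
exact: le_trans ler01 (iter_exp1_ge1 R k).
Qed.

Lemma P_ge (R : realType) k n : n%:R + 1 <= P_ R k n.
Proof.
rewrite /P_ big_ord_recl /= {1}/iter_ln /=.
have ge1 : 1 <= \prod_(i < k) iter_ln (bump 0 i) (n%:R + iter_exp1 R k).
  elim/big_ind: _ => [//|a b a1 b1|i _].
    by rewrite (le_trans a1)// ler_peMr// (le_trans ler01).
  by apply: (@iter_ln_ge1 _ k); [exact: ltn_ord | rewrite lerDr].
have e1 := iter_exp1_ge1 R k.
have n0 : 0 <= n%:R :> R by [].
by apply: le_trans (ler_peMr _ ge1); lra.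
Qed.

(** * The trajectory enters the region h_n x_n^2 < 1 *)

(** The bracket changes sign when h y^2 >= 1, so the linear term has the sign
    opposite to the cubic one and absorbs the noise. *)
Lemma cubic_step_le (R : realType) (h y f : R) :
  1 <= h * y ^+ 2 -> `|f| <= `|y| -> `|y * (1 - h * y ^+ 2) + f| <= h * `|y| ^+ 3.
Proof.
move=> hy fy; apply: le_trans (ler_normD _ _) _.
rewrite normrM distrC [`|_ - 1|]ger0_norm ?subr_ge0//.
rewrite -[y ^+ 2]real_normK ?num_real//.
have -> : `|y| * (h * `|y| ^+ 2 - 1) = h * `|y| ^+ 3 - `|y| by ring.
lra.
Qed.

(** If the trajectory stayed outside, ln |y_n| / 3^n would decrease by q_n at
    each step while remaining nonnegative. *)
Lemma enters_region (R : realType) (h y f q : nat -> R)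
    (h_gt0 : forall n, 0 < h n) (h_le1 : forall n, h n <= 1)
    (h_le : forall n, h n <= expR (- (3 ^+ n.+1 * q n)))
    (q_unbounded : forall A, exists n, A < \sum_(i < n) q i)
    (f_le1 : forall n, `|f n| <= 1)
    (yS : forall n, y n.+1 = y n * (1 - h n * y n ^+ 2) + f n) :
  exists n, h n * y n ^+ 2 < 1.
Proof.
apply: contrapT => /forallNP hyN.
have {hyN} hy n : 1 <= h n * y n ^+ 2 by rewrite leNgt; apply/negP/hyN.
have y_ge1 n : 1 <= `|y n|.
  rewrite -[_ <= _](@ler_pXn2r _ 2)// ?nnegrE// expr1n real_normK ?num_real//.
  by rewrite (le_trans (hy n))// ler_piMl// sqr_ge0.
have lny n : ln `|y n| <= 3 ^+ n * (ln `|y 0%N| - \sum_(i < n) q i).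
  elim: n => [|n IH]; first by rewrite big_ord0 expr0 mul1r subr0.
  have y_gt0 : 0 < `|y n| := lt_le_trans ltr01 (y_ge1 n).
  have lnS : ln `|y n.+1| <= ln (h n) + ln `|y n| *+ 3.
    rewrite -lnXn// -lnM ?posrE ?exprn_gt0// ler_ln ?posrE//.
    - by rewrite yS cubic_step_le// (le_trans (f_le1 n)).
    - exact: lt_le_trans ltr01 (y_ge1 _).
    - by rewrite mulr_gt0// exprn_gt0.
  have lnh : ln (h n) <= - (3 ^+ n.+1 * q n).
    by rewrite -ler_expR lnK ?posrE.
  rewrite big_ord_recr /=; apply: le_trans lnS _.
  have -> : 3 ^+ n.+1 * (ln `|y 0%N| - (\sum_(i < n) q i + q n)) =
      - (3 ^+ n.+1 * q n) + 3 * (3 ^+ n * (ln `|y 0%N| - \sum_(i < n) q i)) :> R.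
    by rewrite exprS; ring.
  by rewrite lerD// -[ln _ *+ 3]mulr_natl ler_wpM2l.
have [n] := q_unbounded (ln `|y 0%N|).
apply/negP; rewrite -leNgt -subr_ge0 -(pmulr_rge0 _ (_ : 0 < 3 ^+ n))//.
exact: le_trans (ln_ge0 (y_ge1 n)) (lny n).
Qed.

(** * Inside the region *)

(** The region is invariant, even when the step shrinks from h to h'. With
    s = sqrt(h) and u = s y, the claim is |u (1 - u^2) + s f| <= 1 for
    |u| <= 1, and each of the two summands is at most 1/2. *)
Lemma region_step (R : realType) (h h' y f : R) :
  0 < h -> 0 <= h' <= h -> h <= 1 -> h * y ^+ 2 <= 1 -> `|f| <= 2^-1 ->
  h' * (y * (1 - h * y ^+ 2) + f) ^+ 2 <= 1.
Proof.
move=> h0 /andP[h'0 h'h] h1 hy hf.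
apply: le_trans (ler_wpM2r (sqr_ge0 _) h'h) _.
have [s s0 sh] : exists2 s, 0 <= s & s ^+ 2 = h.
  by exists (Num.sqrt h); rewrite ?sqrtr_ge0// sqr_sqrtr// ltW.
have s1 : s <= 1 by rewrite -(@ler_pXn2r _ 2)// ?nnegrE// expr1n sh.
rewrite -sh -exprMn in hy *; rewrite -exprMn.
rewrite -(@real_normK _ (s * _)) ?num_real// exprn_ile1//.
set u := s * y in hy.
have -> : s * (y * (1 - u ^+ 2) + f) = u * (1 - u ^+ 2) + s * f by rewrite /u; ring.
have usmall : `|u * (1 - u ^+ 2)| <= 2^-1.
  rewrite normrM [X in _ * X]ger0_norm ?subr_ge0// -[u ^+ 2]real_normK ?num_real//.
  have := normr_ge0 u; set t := `|u| => t0.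
  (* The concave t - t^3 lies below its tangent at 3/5, a rational point close
     to the maximizer 1 / sqrt 3. *)
  have : 0 <= (t - 3 / 5) ^+ 2 * (t + 6 / 5) by rewrite mulr_ge0 ?sqr_ge0//; lra.
  have -> : (t - 3 / 5) ^+ 2 * (t + 6 / 5) = t ^+ 3 - 27 / 25 * t + 54 / 125 by field.
  have -> : t * (1 - t ^+ 2) = t - t ^+ 3 by ring.
  lra.
apply: le_trans (ler_normD _ _) _.
have : `|s * f| <= 2^-1.
  by rewrite normrM (ger0_norm s0) (le_trans _ hf)// ler_piMl.
lra.
Qed.

(** |y| is a Lyapunov function inside the region. *)
Lemma cubic_step_energy (R : realType) (h y f : R) :
  h * y ^+ 2 <= 1 ->
  `|y * (1 - h * y ^+ 2) + f| <= `|y| - h * `|y| ^+ 3 + `|f|.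
Proof.
move=> hy; apply: le_trans (ler_normD _ _) _.
rewrite normrM (ger0_norm (_ : 0 <= 1 - _)) ?subr_ge0//.
rewrite -[y ^+ 2]real_normK ?num_real// lerD2r.
by have -> : `|y| * (1 - h * `|y| ^+ 2) = `|y| - h * `|y| ^+ 3 by ring.
Qed.

Lemma bounded_nneg_series_cvg (R : realType) (u : nat -> R) (M : R) :
  (forall n, 0 <= u n) -> (forall n, series u n <= M) -> cvgn (series u).
Proof.
move=> u0 uM; apply: nondecreasing_is_cvgn.
  by apply: (@nondecreasing_series R u xpredT 0%N) => n _ _.
by exists M => _ [n _ <-].
Qed.

Lemma series_shift_cvg (R : realType) (u : nat -> R) m :
  cvgn (series u) -> cvgn (series (fun n => u (n + m)%N)).
Proof.
rewrite -(@is_cvg_series_restrict m) => /cvg_ex[l]; rewrite -(cvg_shiftn m) => ul.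
apply/cvg_ex; exists l; apply: cvg_trans ul.
apply: near_eq_cvg; near=> n => /=.
by rewrite /series /= -{1}[m]add0n big_addn addnK.
Unshelve. all: by end_near. Qed.

(** Summing [cubic_step_energy]: the total dissipation is at most |y_0| plus the
    total noise. *)
Lemma dissipation_summable (R : realType) (h y f : nat -> R)
    (h_gt0 : forall n, 0 < h n) (h_le1 : forall n, h n <= 1)
    (h_noninc : nonincreasing_seq h)
    (f_le : forall n, `|f n| <= 2^-1) (f_sum : cvgn (series (fun n => `|f n|)))
    (yS : forall n, y n.+1 = y n * (1 - h n * y n ^+ 2) + f n)
    (hy0 : h 0%N * y 0%N ^+ 2 <= 1) :
  cvgn (series (fun n => h n * `|y n| ^+ 3)).
Proof.
have hy n : h n * y n ^+ 2 <= 1.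
  elim: n => [//|n IH]; rewrite yS region_step//.
  by rewrite ltW//= h_noninc.
have d_ge0 n : 0 <= h n * `|y n| ^+ 3 by rewrite mulr_ge0 ?exprn_ge0// ltW.
have energy n : series (fun n => h n * `|y n| ^+ 3) n + `|y n| <=
    `|y 0%N| + series (fun n => `|f n|) n.
  elim: n => [|n IH]; first by rewrite /series /= !big_geq// add0r addr0.
  have := @cubic_step_energy R (h n) (y n) (f n) (hy n).
  rewrite -yS !seriesSr; move: IH; lra.
set S := limn (series (fun n => `|f n|)).
apply: (@bounded_nneg_series_cvg _ _ (`|y 0%N| + S)) => // n.
have := energy n; have := normr_ge0 (y n).
have : series (fun n => `|f n|) n <= S.
  apply: nondecreasing_cvgn_le => //.
  by apply: (@nondecreasing_series R _ xpredT 0%N) => ? _ _.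
lra.
Qed.

(** The increments of y are absolutely summable. *)
Lemma cubic_cvg (R : realType) (h y f : nat -> R)
    (h_gt0 : forall n, 0 < h n)
    (f_sum : cvgn (series (fun n => `|f n|)))
    (yS : forall n, y n.+1 = y n * (1 - h n * y n ^+ 2) + f n)
    (d_sum : cvgn (series (fun n => h n * `|y n| ^+ 3))) :
  cvgn y.
Proof.
have tel_cvg : cvgn (series (telescope y)).
  apply: normed_cvg.
  apply: series_le_cvg (is_cvg_seriesD d_sum f_sum) => n //=.
    by rewrite addr_ge0// mulr_ge0 ?exprn_ge0// ltW.
  rewrite -[telescope y n]/(y n.+1 - y n) yS.
  have -> : y n * (1 - h n * y n ^+ 2) + f n - y n = - (h n * y n ^+ 3) + f n by ring.
  apply: le_trans (ler_normD _ _) _.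
  by rewrite normrN normrM normrX (ger0_norm (ltW (h_gt0 n))).
rewrite telescopeK in tel_cvg.
have : cvgn ((y - cst (y 0%N)) + cst (y 0%N)) by apply: is_cvgD => //; exact: is_cvg_cst.
by rewrite subrK.
Qed.

Section ByIndex.
Variables (R : realType) (h f : nat -> R) (x0 : R) (m : nat).
Hypotheses (h_gt0 : forall n, 0 < h n) (h_le1 : forall n, h n <= 1)
  (h_noninc : nonincreasing_seq h)
  (f_le : forall n, `|f n.+1| <= 2^-1)
  (f_sum : cvgn (series (fun n => `|f n.+1|)))
  (hm : h m * cubic_sol h f x0 m ^+ 2 <= 1).
Let y n := cubic_sol h f x0 (n + m).

Let yS n : y n.+1 = y n * (1 - h (n + m)%N * y n ^+ 2) + f (n + m).+1.
Proof. by []. Qed.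

Let f_sumS : cvgn (series (fun n => `|f (n + m).+1|)).
Proof. exact: (@series_shift_cvg _ (fun n => `|f n.+1|)). Qed.

Let d_sum : cvgn (series (fun n => h (n + m)%N * `|y n| ^+ 3)).
Proof.
apply: (@dissipation_summable R (fun n => h (n + m)%N) y (fun n => f (n + m).+1)) => //.
by move=> i j ij; rewrite h_noninc// leq_add2r.
Qed.

Lemma cubic_sol_cvg : cvgn (cubic_sol h f x0).
Proof.
have /cvg_ex[l yl] : cvgn y.
  exact: (@cubic_cvg R (fun n => h (n + m)%N) y (fun n => f (n + m).+1)).
by apply/cvg_ex; exists l; rewrite -(cvg_shiftn m).
Qed.

(** With a constant positive step, summable dissipation means that |y_n|^3 is
    summable. *)
Lemma cubic_sol_cvg0 : (forall n, (m <= n)%N -> h n = h m) ->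
  cubic_sol h f x0 n @[n --> \oo] --> (0 : R).
Proof.
move=> h_cst; rewrite -(cvg_shiftn m) -/y.
have y3 : h m * `|y n| ^+ 3 @[n --> \oo] --> (0 : R).
  have := cvg_series_cvg_0 d_sum.
  by under eq_fun do rewrite (h_cst _ (leq_addl _ _)).
apply/cvgr0Pnorm_le => e e0; near=> n.
rewrite -(@ler_pXn2r _ 3)// ?nnegrE ?(ltW e0)// -(ler_pM2l (h_gt0 m)).
near: n; apply: (cvgr_le _ y3); by rewrite mulr_gt0// exprn_gt0.
Unshelve. all: by end_near. Qed.

End ByIndex.

Lemma cubic_sol_eq (R : realType) (h h' f : nat -> R) x0 m :
  (forall n, (n < m)%N -> h n = h' n) ->
  cubic_sol h f x0 m = cubic_sol h' f x0 m.
Proof.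
elim: m => [//|m IH] hh' /=.
by rewrite IH ?hh'// => n nm; rewrite hh'// ltnW.
Qed.

Lemma stopped_step_noninc (R : realType) (h : nat -> R) m :
  nonincreasing_seq h -> nonincreasing_seq (stopped_step h (Some m)).
Proof.
move=> h_noninc i j ij; rewrite /stopped_step.
case: ltnP => jm; case: ltnP => im //; apply: h_noninc => //.
- exact: leq_trans ij.
- exact: ltnW.
Qed.

Lemma stopped_cubic_sol_cvg0 (R : realType) (h f : nat -> R) (x0 : R) m
    (h_gt0 : forall n, 0 < h n) (h_le1 : forall n, h n <= 1)
    (h_noninc : nonincreasing_seq h)
    (f_le : forall n, `|f n.+1| <= 2^-1)
    (f_sum : cvgn (series (fun n => `|f n.+1|)))
    (hm : h m * cubic_sol h f x0 m ^+ 2 <= 1) :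
  cubic_sol (stopped_step h (Some m)) f x0 n @[n --> \oo] --> (0 : R).
Proof.
have stopE n : (m <= n)%N -> stopped_step h (Some m) n = h m.
  by rewrite /stopped_step ltnNge => ->.
apply: (@cubic_sol_cvg0 _ _ _ _ m) => //.
- by move=> n; rewrite /stopped_step; case: ifP.
- by move=> n; rewrite /stopped_step; case: ifP.
- exact: stopped_step_noninc.
- rewrite stopE// (@cubic_sol_eq _ _ h)// => n nm.
  by rewrite /stopped_step nm.
- by move=> n mn; rewrite !stopE.
Qed.

(** * Consequences of Conditions (A) and (B) *)

(** The only feature of the steps that matters for entering the region: q_n is
    1 / P_k(n) under (A) and 1 under (B). *)
Lemma condition_step_le (R : realType) (h w : nat -> R) :
  condition_A h w \/ condition_B h w ->
  exists q : nat -> R,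
    [/\ forall n, 0 <= q n,
        forall n, h n <= expR (- (3 ^+ n.+1 * q n)) &
        forall A, exists n, A < \sum_(i < n) q i].
Proof.
move=> [[k [b [_ _ hle _]]]|[b [_ hle _]]].
  exists (fun n => (P_ R k n)^-1); split => //; last exact: sum_invP_unbounded.
  by move=> n; rewrite invr_ge0 (le_trans _ (P_ge _ k n))// addr_ge0.
exists (fun=> 1); split => // [n|A]; first by rewrite mulr1.
exists (Num.bound `|A|); rewrite sumr_const card_ord.
exact: le_lt_trans (ler_norm A) (archi_boundP _).
Qed.

(** From 1/2 <= exp (-1/2). It makes (e - 1) / e at most 3/4 in Condition (B). *)
Lemma expR1_le4 (R : realType) : expR 1 <= 4 :> R.
Proof.
have := @expR_ge1Dx R (- 2^-1).
have -> : expR 1 = (expR (- 2^-1)) ^- 2 :> R.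
  by rewrite -expRM_natl -expRN; congr expR; rewrite mulrN opprK mulfV.
move=> e2; rewrite -[4]invrK lef_pV2 ?posrE ?exprn_gt0 ?expR_gt0//.
have : (1 - 2^-1) ^+ 2 <= expR (- 2^-1) ^+ 2 :> R by rewrite ler_pXn2r// nnegrE; lra.
apply: le_trans; lra.
Qed.

(** Both conditions bound the noise by c^(3^(n+1)) with c <= 3/4: under (A)
    because P_k(n) >= 2 for n >= 1, under (B) because (e - 1) / e <= 3/4. As
    3^(n+1) >= n + 3 and (3/4)^3 <= 1/2, the noise is at once summable and never
    above 1/2. *)
Lemma condition_noise_le (R : realType) (h w : nat -> R) :
  condition_A h w \/ condition_B h w ->
  forall n, `|w n.+1| <= (3 / 4) ^+ n * 2^-1.
Proof.
move=> hAB n.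
have [c /andP[c0 c34] wc] : exists2 c, 0 <= c <= 3 / 4 & `|w n.+1| <= c ^+ (3 ^ n.+1).
  case: hAB => [[k [b [/andP[b0 b1] _ _ /(_ n.+1 isT) wle]]]|].
    exists (b / P_ R k n.+1) => //.
    have P2 : 2 <= P_ R k n.+1.
      by apply: le_trans (P_ge _ _ _); rewrite natr1 ler_nat.
    have P0 : 0 < P_ R k n.+1 by lra.
    by rewrite divr_ge0 ?(ltW b0) ?(ltW P0)//= ler_pdivrMr//; lra.
  case=> b [/andP[b0 b1] _ /(_ n.+1 isT) wle].
  exists (b * (expR 1 - 1) / expR 1) => //.
  have e4 := expR1_le4 R; have e0 : 0 < expR 1 :> R := expR_gt0 1.
  have e1 : 1 + 1 <= expR 1 :> R := expR_ge1Dx 1.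
  rewrite divr_ge0 ?mulr_ge0 ?(ltW b0) ?(ltW e0) ?subr_ge0//=; last lra.
  rewrite ler_pdivrMr//.
  have : b * (expR 1 - 1) <= 1 * (expR 1 - 1) :> R.
    by rewrite ler_wpM2r ?(ltW b1)//; lra.
  lra.
apply: (le_trans wc).
have n3 : (n + 3 <= 3 ^ n.+1)%N.
  by elim: n {wc} => [//|n IH]; rewrite expnS; move: IH; lia.
apply: (@le_trans _ _ (c ^+ (n + 3))).
  by rewrite ler_wiXn2l//; lra.
apply: (@le_trans _ _ ((3 / 4) ^+ (n + 3))).
  by rewrite lerXn2r// nnegrE; lra.
rewrite exprD ler_wpM2l// ?exprn_ge0//; lra.
Qed.

(** * The random recursion *)

Lemma measurable_cubic_sol (R : realType) (d : measure_display)
    (T : measurableType d) (h : nat -> R) (f : T -> nat -> R) (x0 : R) :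
  (forall n, measurable_fun setT (fun w => f w n)) ->
  forall n, measurable_fun setT (fun w => cubic_sol h (f w) x0 n).
Proof.
move=> mf; elim=> [|n IH] /=; first exact: measurable_cst.
apply: measurable_funD => //; apply: measurable_funM => //.
apply: measurable_funB; first exact: measurable_cst.
by apply: measurable_funM; [exact: measurable_cst | exact: measurable_funX].
Qed.

Lemma ae_cvg_rv (R : realType) (d : measure_display) (T : measurableType d)
    (P : probability T R) (X : T -> nat -> R) :
  (forall n, measurable_fun setT (fun w => X w n)) ->
  {ae P, forall w, cvgn (X w)} ->
  exists L : {RV P >-> R}, {ae P, forall w, X w n @[n --> \oo] --> L w}.
Proof.
move=> mX cX.
(* The limit superior is measurable everywhere, also where X diverges. *)
pose L w := fine (limn_esup (fun n => (X w n)%:E)).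
have mL : measurable_fun setT L.
  apply: (measurableT_comp (fine_measurable measurableT)) => //.
  apply: measurable_fun_limn_esup => n.
  exact: measurableT_comp.
pose mLb := isMeasurableFun.Build _ _ _ _ L mL.
pose LRV : {RV P >-> R} := HB.pack L mLb.
exists LRV; apply: filterS cX => w cXw.
suff -> : LRV w = limn (X w) by exact: cXw.
rewrite /LRV /= /L is_cvg_limn_esupE ?EFin_lim//.
by apply: cvg_EFin; [exact: nearW|exact: cXw].
Qed.

Theorem theorem1 (R : realType) (d : measure_display) (T : measurableType d)
    (P : probability T R) (cP : measure_is_complete P)
    (x0 : R) (h rho : nat -> R)
    (h_gt0 : forall n, 0 < h n) (h_noninc : nonincreasing_seq h)
    (rho_ge0 : forall n, (1 <= n)%N -> 0 <= rho n)
    (hAB : condition_A h rho \/ condition_B h rho)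
    (xi : nat -> {RV P >-> R})
    (xi_le1 : forall n, (1 <= n)%N -> {ae P, forall w, `|xi n w| <= 1})
    (N3 : T -> option nat)
    (mN3 : forall n, measurable (N3 @^-1` [set Some n])) :
  let noise w n := rho n * xi n w in
  let x w := cubic_sol h (noise w) x0 in
  let xhat w := cubic_sol (stopped_step h (N3 w)) (noise w) x0 in
  {ae P, forall w, stopping_index h (x w) (N3 w)} ->
  (exists L : {RV P >-> R}, {ae P, forall w, x w n @[n --> \oo] --> L w}) /\
  {ae P, forall w, xhat w n @[n --> \oo] --> (0 : R)}.
Proof.
move=> noise x xhat aeN3.
have [q [q_ge0 h_le q_unb]] := condition_step_le R h rho hAB.
have h_le1 n : h n <= 1.
  by rewrite (le_trans (h_le n))// expR_le1 oppr_le0 mulr_ge0.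
have aexi : {ae P, forall w, forall n, `|xi n.+1 w| <= 1}.
  by apply: ae_foralln => n; exact: xi_le1.
have noise_le w : (forall n, `|xi n.+1 w| <= 1) ->
    forall n, `|noise w n.+1| <= (3 / 4) ^+ n * 2^-1.
  move=> xiw n; apply: le_trans (condition_noise_le R h rho hAB n).
  by rewrite /noise normrM ler_piMr.
have noise_half w : (forall n, `|xi n.+1 w| <= 1) ->
    forall n, `|noise w n.+1| <= 2^-1.
  move=> /noise_le nw n; apply: le_trans (nw n) _.
  by rewrite ler_piMl// exprn_ile1//; lra.
have noise_sum w : (forall n, `|xi n.+1 w| <= 1) ->
    cvgn (series (fun n => `|noise w n.+1|)).
  move=> /noise_le nw.
  have q_lt1 : `|3 / 4| < 1 :> R by rewrite ger0_norm; lra.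
  apply: series_le_cvg (@is_cvg_geometric_series R 2^-1 _ q_lt1) => //.
  - by move=> n; rewrite /= mulr_ge0// exprn_ge0//; lra.
  - by move=> n; rewrite /= mulrC.
have entry w : (forall n, `|xi n.+1 w| <= 1) -> exists n, h n * x w n ^+ 2 < 1.
  move=> xiw; apply: (enters_region R h (x w) (fun n => noise w n.+1) q) => // n.
  by rewrite (le_trans (noise_half w xiw n))//; lra.
split.
  apply: ae_cvg_rv => [n|].
    apply: measurable_cubic_sol => k.
    by apply: measurable_funM => //; exact: measurable_cst.
  apply: filterS aexi => w xiw.
  have [m hm] := entry w xiw.
  apply: (@cubic_sol_cvg _ _ _ _ m) => //; last exact: ltW.
    exact: noise_half.
  exact: noise_sum.
apply: filterS2 aexi aeN3 => w xiw Nw.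
suff [m Nm hm] : exists2 m, N3 w = Some m & h m * x w m ^+ 2 <= 1.
  rewrite /xhat Nm; apply: stopped_cubic_sol_cvg0 => //.
    exact: noise_half.
  exact: noise_sum.
case: Nw => [[m Nm xm]|].
  exists m => //; rewrite mulr_ile1 ?sqr_ge0 ?(ltW (h_gt0 m))//.
  by rewrite -real_normK ?num_real// exprn_ile1.
case: (N3 w) => [m [/ltW hm _]|none]; first by exists m.
have [m hm] := entry w xiw.
by move: none => /seteqP[/(_ m)]; case.
Qed.
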